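(* Let $n\in\mathbb{Z}_+^d$ be a prebasis and $N=\prod_{i=1}^d n[i]$. For every $x\in\Sigma_N^{\mathbb{Z}}$ there is a unique $f\in X_n$ such that $\mathrm{val}_n(f[\mathbf{i}])=x[i]$ for all $i\in\mathbb{Z}$.
   Context: $\mathbb{N}=\{0,1,2,\dots\}$, $\mathbb{Z}_+$ is the set of positive integers, $\Sigma_N=\{0,\dots,N-1\}$. Vectors are ordered coordinatewise; for an integer $k$, $\mathbf{k}=(k,\dots,k)$ is the constant vector; $e_i$ are the standard basis vectors. A prebasis of dimension $d$ is any $n\in\mathbb{Z}_+^d$; for $v\in\mathbb{Z}^d$, $m(n,v)=\prod_{j=1}^d n[j]^{-v[j]}$. For $a\in\mathbb{N}$ and $\mathbf{0}\ge v_1\ge v_2$ in $\mathbb{Z}^d$, $\mathrm{base}_n(a,(v_1,v_2))[2]$ denotes the integer $a_1$ in the unique representation $a=a_0+a_1m(n,v_1)+a_2m(n,v_2)$ with integers $0\le a_0<m(n,v_1)$, $0\le a_1<m(n,v_2)/m(n,v_1)$, $a_2\ge0$. For $a\in\Sigma_N$, the multiplication cube $\mathrm{cube}_n(a)$ is the function on pairs $v_1\ge v_2$ in $\{-1,0\}^d$ given by $\mathrm{cube}_n(a)[v_1,v_2]=\mathrm{base}_n(a,(v_1,v_2))[2]$. $T_n=\{\mathrm{cube}_n(a):a\in\Sigma_N\}$ and $\mathrm{val}_n(t)=t[\mathbf{0},-\mathbf{1}]$ for $t\in T_n$ (so $\mathrm{val}_n(\mathrm{cube}_n(a))=a$). $X_n$,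 the set of valid tessellations, is the set of maps $f:\mathbb{Z}^d\to T_n$ such that $f[z][\mathbf{0},-\mathbf{1}+e_i]=f[z+e_i][-e_i,-\mathbf{1}]$ for all $z\in\mathbb{Z}^d$, $1\le i\le d$. *)

(* Defs.v *)
From mathcomp Require Import all_boot all_order all_algebra.
From mathcomp Require Import boolp classical_sets.

Set Implicit Arguments.
Unset Strict Implicit.
Unset Printing Implicit Defensive.

Import Order.TTheory GRing.Theory Num.Theory.
Local Open Scope ring_scope.
Local Open Scope classical_set_scope.

Definition prebasis d (n : 'I_d -> nat) : Prop := forall j, (0 < n j)%N.

Definition evec d (i : 'I_d) : 'rV[int]_d := delta_mx 0 i.

Definition vle d (u v : 'rV[int]_d) : bool := [forall j, u 0 j <= v 0 j].

Definition mbase d (n : 'I_d -> nat) (v : 'rV[int]_d) : rat :=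
  \prod_(j < d) (n j)%:R ^ (- v 0 j).

Definition base_rep d (n : 'I_d -> nat) (a : nat) (v1 v2 : 'rV[int]_d)
    (r : nat * nat * nat) : Prop :=
  let: (a0, a1, a2) := r in
  [/\ a%:R = a0%:R + a1%:R * mbase n v1 + a2%:R * mbase n v2,
      a0%:R < mbase n v1
    & a1%:R < mbase n v2 / mbase n v1].

(* The triple (a_0, a_1, a_2), chosen among all representations. It is       *)
(* meaningful only for a prebasis n and 0 >= v1 >= v2, where the             *)
(* representation exists and is unique: see base_rep_unique.                 *)
Definition base d (n : 'I_d -> nat) (a : nat) (v1 v2 : 'rV[int]_d) :
    nat * nat * nat :=
  xget (0%N, 0%N, 0%N) (base_rep n a v1 v2).

Definition base2 d (n : 'I_d -> nat) (a : nat) (v1 v2 : 'rV[int]_d) : nat :=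
  (base n a v1 v2).1.2.

Lemma mbase_nat d (n : 'I_d -> nat) (v : 'rV[int]_d) :
  prebasis n -> vle v 0 -> exists2 m, (0 < m)%N & mbase n v = m%:R.
Proof.
move=> n_gt0 /forallP v_le0; exists (\prod_(j < d) n j ^ `|v 0%R j|)%N.
  by apply: prodn_gt0 => j; rewrite expn_gt0 n_gt0.
rewrite natr_prod; apply: eq_bigr => j _.
have := v_le0 j; rewrite mxE => vj.
by rewrite -[- v 0 j]gez0_abs ?oppr_ge0// abszN natrX.
Qed.

Lemma mbase_quo d (n : 'I_d -> nat) (v1 v2 : 'rV[int]_d) :
  prebasis n -> mbase n v2 / mbase n v1 = mbase n (v2 - v1).
Proof.
move=> n_gt0; rewrite /mbase -prodf_div; apply: eq_bigr => j _.
have nj0 : (n j)%:R != 0 :> rat by rewrite pnatr_eq0 -lt0n n_gt0.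
by rewrite !mxE opprB expfzDr// mulrC invr_expz opprK.
Qed.

Lemma base_rep_unique d (n : 'I_d -> nat) (a : nat) (v1 v2 : 'rV[int]_d) :
  prebasis n -> vle v1 0 -> vle v2 v1 ->
  exists! r, base_rep n a v1 v2 r.
Proof.
move=> n_gt0 v1_le0 v2_le1.
have [m1 m1_gt0 m1E] := mbase_nat n_gt0 v1_le0.
have [|q q_gt0 qE] := @mbase_nat _ _ (v2 - v1) n_gt0.
  by apply/forallP => j; have := forallP v2_le1 j; rewrite !mxE subr_le0.
have m2E : mbase n v2 = (q * m1)%:R.
  rewrite natrM -m1E -qE -mbase_quo// divfK//.
  by rewrite m1E pnatr_eq0 -lt0n.
have repE a0 a1 a2 : base_rep n a v1 v2 (a0, a1, a2) <->
    [/\ a = (a0 + a1 * m1 + a2 * (q * m1))%N, (a0 < m1)%N & (a1 < q)%N].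
  rewrite /base_rep mbase_quo// qE m2E m1E !ltr_nat -!natrM -!natrD.
  by split=> -[/eqP e ? ?]; split=> //; apply/eqP; move: e; rewrite eqr_nat.
exists (a %% m1, (a %/ m1) %% q, (a %/ m1) %/ q)%N; split.
  apply/repE; split; rewrite ?ltn_mod//.
  by rewrite mulnA -addnA -mulnDl [(_ %% q + _)%N]addnC -divn_eq addnC -divn_eq.
move=> [[a0 a1] a2] /repE[-> a0_lt a1_lt].
rewrite mulnA -addnA -mulnDl.
have m1_div : ((a0 + (a1 + a2 * q) * m1) %/ m1)%N = (a1 + a2 * q)%N.
  by rewrite addnC divnMDl// divn_small ?addn0.
have m1_mod : ((a0 + (a1 + a2 * q) * m1) %% m1)%N = a0.
  by rewrite addnC modnMDl modn_small.
rewrite m1_div m1_mod; congr (_, _, _).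
  by rewrite addnC modnMDl modn_small.
by rewrite addnC divnMDl// divn_small ?addn0.
Qed.

Definition unit_cube d (v : 'rV[int]_d) : bool :=
  [forall j, v 0 j \in [:: -1; 0]].

Definition cube_pair d (p : 'rV[int]_d * 'rV[int]_d) : bool :=
  [&& unit_cube p.1, unit_cube p.2 & vle p.2 p.1].

Definition cube_index d : Type :=
  {p : 'rV[int]_d * 'rV[int]_d | cube_pair p}.

Definition cube_type d : Type := cube_index d -> nat.

Definition cube d (n : 'I_d -> nat) (a : nat) : cube_type d :=
  fun p => base2 n a (sval p).1 (sval p).2.

Definition prebasis_prod d (n : 'I_d -> nat) : nat := (\prod_(j < d) n j)%N.

Definition cubes d (n : 'I_d -> nat) : set (cube_type d) :=
  [set t | exists a : 'I_(prebasis_prod n), t = cube n a].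

Lemma full_pair d : cube_pair (0 : 'rV[int]_d, const_mx (-1) : 'rV[int]_d).
Proof. by apply/and3P; split; apply/forallP => j; rewrite !mxE. Qed.

Lemma low_pair d (i : 'I_d) : cube_pair (0, const_mx (-1) + evec i).
Proof.
by apply/and3P; split; apply/forallP => j; rewrite !mxE//; case: (j == i).
Qed.

Lemma high_pair d (i : 'I_d) : cube_pair (- evec i, const_mx (-1)).
Proof.
by apply/and3P; split; apply/forallP => j; rewrite !mxE//; case: (j == i).
Qed.

Definition full_index d : cube_index d :=
  exist _ (0, const_mx (-1)) (full_pair d).

Definition low_index d (i : 'I_d) : cube_index d :=
  exist _ (0, const_mx (-1) + evec i) (low_pair i).

Definition high_index d (i : 'I_d) : cube_index d :=
  exist _ (- evec i, const_mx (-1)) (high_pair i).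

Definition cube_val d (t : cube_type d) : nat := t (full_index d).

Definition tessellations d (n : 'I_d -> nat) :
    set ('rV[int]_d -> cube_type d) :=
  [set f : 'rV[int]_d -> cube_type d |
    (forall z, cubes n (f z)) /\
    (forall z i, f z (low_index i) = f (z + evec i) (high_index i))].

(* Main.v *)
(* Writing a tessellation through its values [a], the matching condition says
   that a(z + e_i) drops the top base-[n i] digit of a(z) and appends a new
   lowest one, that is
   a(z) mod (N / n_i) = floor (a(z + e_i) / n_i).
   Existence: read the digits [x (-K), ..., x (K - 1)] as one base-[N] number
   [W] and set a(z) = floor (W / prod_j n_j^(K - 1 - z_j)) mod N; this does not
   depend on [K] as long as -K <= z_j < K for all [j].
   Uniqueness: iterating the matching condition along the directions of a set
   [S] shows that a(z) and a(z + 1) determine a(z + e_S), the first giving its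
   quotient and the second its remainder modulo prod_(j in S) n_j. So the values
   spread from the diagonal by induction on max_j z_j - min_j z_j. *)
Require Import Defs.
From mathcomp Require Import all_boot all_order all_algebra.
From mathcomp Require Import boolp zify.
From mathcomp Require classical_sets.

Set Implicit Arguments.
Unset Strict Implicit.
Unset Printing Implicit Defensive.

Import Order.TTheory GRing.Theory Num.Theory.
Local Open Scope ring_scope.

(** * Cube entries as quotients and remainders *)

Lemma base2_divn_modn d (n : 'I_d -> nat) (a m q : nat) (v1 v2 : 'rV[int]_d) :
  prebasis n -> vle v1 0 -> vle v2 v1 ->
  mbase n v1 = m%:R -> mbase n (v2 - v1) = q%:R ->
  base2 n a v1 v2 = (a %/ m %% q)%N.
Proof.
move=> n_gt0 v1_le0 v2_le1 mE qE.
have mbase_gt0 v : 0 < mbase n v.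
  by apply: prodr_gt0 => j _; rewrite exprz_gt0// ltr0n n_gt0.
have m_gt0 : (0 < m)%N by rewrite -(ltr_nat rat) -mE.
have q_gt0 : (0 < q)%N by rewrite -(ltr_nat rat) -qE.
have mqE : mbase n v2 = (q * m)%:R.
  by rewrite natrM -mE -qE -mbase_quo// divfK// gt_eqF.
(* Dividing by [m], then by [q], yields a representation; by uniqueness it is the one that [xget]
   picks. *)
have rep : base_rep n a v1 v2 (a %% m, a %/ m %% q, a %/ m %/ q)%N.
  rewrite /base_rep mbase_quo// qE mqE mE !ltr_nat !ltn_mod; split=> //.
  rewrite -!natrM -!natrD; congr (_%:R).
  by rewrite mulnA -addnA -mulnDl [(_ %% q + _)%N]addnC -divn_eq addnC -divn_eq.
have [r [_ r_unique]] := base_rep_unique a n_gt0 v1_le0 v2_le1.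
rewrite /base2 /base (classical_sets.xget_unique _ rep)// => y y_rep.
by rewrite -(r_unique _ rep) (r_unique _ y_rep).
Qed.

Lemma prebasis_prodX d (n : 'I_d -> nat) k :
  (prebasis_prod n ^ k = \prod_j n j ^ k)%N.
Proof. exact: (big_morph _ (fun a b => expnMn a b k) (exp1n k)). Qed.

Definition set_prod d (n : 'I_d -> nat) (S : {set 'I_d}) : nat :=
  (\prod_(j in S) n j)%N.

Definition set_vec d (S : {set 'I_d}) : 'rV[int]_d := \row_j (j \in S)%:R.

Lemma set_prod_gt0 d (n : 'I_d -> nat) (S : {set 'I_d}) :
  prebasis n -> (0 < set_prod n S)%N.
Proof. by move=> n_gt0; apply: prodn_gt0. Qed.

Lemma set_prodT d (n : 'I_d -> nat) : set_prod n [set: 'I_d] = prebasis_prod n.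
Proof. by apply: eq_bigl => j; rewrite inE. Qed.

Lemma set_prod1C d (n : 'I_d -> nat) (i : 'I_d) :
  prebasis_prod n = (n i * set_prod n [set~ i])%N.
Proof.
rewrite /prebasis_prod (bigD1 i)//=; congr (_ * _)%N.
by apply: eq_bigl => j; rewrite !inE.
Qed.

Lemma prebasis_prod_gt0 d (n : 'I_d -> nat) :
  prebasis n -> (0 < prebasis_prod n)%N.
Proof. by move=> n_gt0; rewrite -set_prodT set_prod_gt0. Qed.

(** Turns the corners of the unit cube into subproducts of N, the divisors and moduli of all cube
    entries below. *)
Lemma mbaseN_set_vec d (n : 'I_d -> nat) (S : {set 'I_d}) :
  mbase n (- set_vec S) = (set_prod n S)%:R.
Proof.
rewrite /mbase /set_prod natr_prod [RHS]big_mkcond; apply: eq_bigr => j _.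
by rewrite !mxE opprK; case: (j \in S).
Qed.

Lemma cube_valE d (n : 'I_d -> nat) (a : nat) :
  prebasis n -> cube_val (cube n a) = (a %% prebasis_prod n)%N.
Proof.
move=> n_gt0; rewrite /cube_val /cube /=.
have /and3P[_ _ v2_le1] := full_pair d.
have v1_le0 : vle 0 (0 : 'rV[int]_d) by apply/forallP => j.
rewrite (@base2_divn_modn _ _ _ 1 (prebasis_prod n))// ?divn1//.
  by rewrite /mbase big1// => j _; rewrite mxE.
rewrite -set_prodT -mbaseN_set_vec; congr mbase.
by apply/rowP => j; rewrite !mxE inE subr0.
Qed.

Lemma cube_low d (n : 'I_d -> nat) (a : nat) (i : 'I_d) :
  prebasis n -> cube n a (low_index i) = (a %% set_prod n [set~ i])%N.
Proof.
move=> n_gt0; rewrite /cube /=.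
have /and3P[_ _ v2_le1] := low_pair i.
have v1_le0 : vle 0 (0 : 'rV[int]_d) by apply/forallP => j.
rewrite (@base2_divn_modn _ _ _ 1 (set_prod n [set~ i]))// ?divn1//.
  by rewrite /mbase big1// => j _; rewrite mxE.
rewrite -mbaseN_set_vec; congr mbase.
by apply/rowP => j; rewrite !mxE !inE subr0; case: (j == i).
Qed.

Lemma cube_high d (n : 'I_d -> nat) (a : nat) (i : 'I_d) :
  prebasis n ->
  cube n a (high_index i) = (a %/ n i %% set_prod n [set~ i])%N.
Proof.
move=> n_gt0; rewrite /cube /=.
have /and3P[_ _ v2_le1] := high_pair i.
have v1_le0 : vle (- evec i) 0.
  by apply/forallP => j; rewrite !mxE; case: (j == i).
rewrite (@base2_divn_modn _ _ _ (n i) (set_prod n [set~ i]))//.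
  rewrite -[n i](big_set1 muln i n) -mbaseN_set_vec; congr mbase.
  by apply/rowP => j; rewrite !mxE inE.
rewrite -mbaseN_set_vec; congr mbase.
by apply/rowP => j; rewrite !mxE !inE; case: (j == i).
Qed.

(** * Tessellations as functions with values below N *)

Definition digit_tessellation d (n : 'I_d -> nat) (a : 'rV[int]_d -> nat) :
    Prop :=
  (forall z, (a z < prebasis_prod n)%N) /\
  (forall z i, a z %% set_prod n [set~ i] = a (z + evec i)%R %/ n i)%N.

Lemma tessellation_digits d (n : 'I_d -> nat) (f : 'rV[int]_d -> cube_type d) :
  prebasis n -> tessellations n f ->
  digit_tessellation n (fun z => cube_val (f z)) /\
  f = (fun z => cube n (cube_val (f z))).
Proof.
move=> n_gt0 [f_cube f_match].
have val_lt z : (cube_val (f z) < prebasis_prod n)%N.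
  by have [a ->] := f_cube z; rewrite cube_valE// ltn_mod prebasis_prod_gt0.
have fE z : f z = cube n (cube_val (f z)).
  by have [a ->] := f_cube z; rewrite cube_valE// modn_small.
split; last exact/funext.
split=> // z i; have := f_match z i.
rewrite [in LHS](fE z) [in RHS](fE (z + _)) cube_low// cube_high//.
(* A value below N has quotient by [n i] below N / n_i, so the remainder in [cube_high]
   disappears. *)
by move=> ->; rewrite modn_small// ltn_divLR// mulnC -set_prod1C.
Qed.

Lemma digits_tessellation d (n : 'I_d -> nat) (a : 'rV[int]_d -> nat) :
  prebasis n -> digit_tessellation n a ->
  tessellations n (fun z => cube n (a z)).
Proof.
move=> n_gt0 [a_lt a_match]; split=> [z|z i].
  by exists (Ordinal (a_lt z)).
rewrite cube_low// cube_high// a_match modn_small//.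
by rewrite ltn_divLR// mulnC -set_prod1C.
Qed.

(** * Uniqueness *)

Lemma digit_set_vec d (n : 'I_d -> nat) (a : 'rV[int]_d -> nat) z S :
  digit_tessellation n a ->
  (a z %% set_prod n (~: S) = a (z + set_vec S)%R %/ set_prod n S)%N.
Proof.
move=> [a_lt a_match]; have [m] := ubnP #|S|.
elim: m S => // m IHm S; have [->|[i iS]] := set_0Vmem S.
  have -> : set_vec set0 = 0 :> 'rV[int]_d by apply/rowP => j; rewrite !mxE inE.
  by rewrite setC0 set_prodT modn_small// addr0 /set_prod big_set0 divn1.
rewrite (cardsD1 i) iS ltnS => /IHm {}IHm.
have -> : set_vec S = set_vec (S :\ i) + evec i.
  apply/rowP => j; rewrite !mxE !inE.
  by case: eqVneq => //= [->|]; rewrite ?iS ?addr0.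
(* Division by [n i] first undoes the step along [i], by matching at [z + set_vec (S :\ i)]. The
   remaining division by [set_prod n (S :\ i)] is the induction hypothesis, read modulo the divisor
   [set_prod n (~: S)]. *)
rewrite addrA {2}/set_prod (big_setD1 i iS)/= divnMA -a_match.
have -> : set_prod n [set~ i] = (set_prod n (~: S) * set_prod n (S :\ i))%N.
  rewrite /set_prod (big_setID (~: S))/=; congr (_ * _)%N; apply: eq_bigl => j.
    by rewrite !inE; case: eqVneq => // ->; rewrite iS.
  by rewrite !inE negbK andbC.
rewrite -modn_divl -IHm modn_dvdm//.
rewrite /set_prod [X in (_ %| X)%N](big_setD1 i) ?inE ?eqxx//=.
have -> : (~: (S :\ i)) :\ i = ~: S.
  by apply/setP => j; rewrite !inE; case: eqVneq => [->|]; rewrite ?iS.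
exact: dvdn_mull.
Qed.

Lemma digit_tessellation_eq d (n : 'I_d -> nat) (a b : 'rV[int]_d -> nat) :
  digit_tessellation n a -> digit_tessellation n b ->
  (forall i : int, a (const_mx i) = b (const_mx i)) -> a =1 b.
Proof.
move=> a_tess b_tess ab_diag.
have spread r (z : 'rV[int]_d) (c : int) :
    (forall j, c <= z 0 j <= c + r%:Z) -> a z = b z.
  elim: r z c => [|r IHr] z c cz.
    have -> : z = const_mx c.
      by apply/rowP => j; have := cz j; rewrite !mxE; lia.
    exact: ab_diag.
  (* [z] lies between [z - set_vec S] and that point shifted by the all-ones
     vector; both of these have spread at most [r]. *)
  pose S := [set j | c < z 0 j].
  have low : a (z - set_vec S) = b (z - set_vec S).
    apply: (IHr _ c) => j; have := cz j; rewrite !mxE inE.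
    by case: ltP => /=; lia.
  have high : a (z + set_vec (~: S)) = b (z + set_vec (~: S)).
    apply: (IHr _ (c + 1)) => j; have := cz j; rewrite !mxE !inE.
    by case: ltP => /=; lia.
  have aS := digit_set_vec (z - set_vec S) S a_tess.
  have bS := digit_set_vec (z - set_vec S) S b_tess.
  have aC := digit_set_vec z (~: S) a_tess.
  have bC := digit_set_vec z (~: S) b_tess.
  rewrite subrK in aS bS; rewrite setCK in aC bC.
  (* The lower neighbour fixes the quotient by [set_prod n S], the upper one the remainder. *)
  rewrite (divn_eq (a z) (set_prod n S)) (divn_eq (b z) (set_prod n S)).
  by rewrite -aS -bS aC bC low high.
move=> z; pose K := (\max_j `|z 0%R j|)%N.
apply: (spread (K + K)%N z (- K%:Z)) => j.
have : (`|z 0%R j| <= K)%N := leq_bigmax j.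
lia.
Qed.

(** * Existence: digits read off a window of the diagonal data *)

Section Existence.
Variables (d : nat) (n : 'I_d -> nat) (x : int -> 'I_(prebasis_prod n)).
Hypothesis n_gt0 : prebasis n.
Let N := prebasis_prod n.

(* The base-[N] number with digits [x (- K), ..., x (K - 1)]. *)
Fixpoint window (K : nat) : nat :=
  if K is K'.+1 then
    (x (- K%:Z) * N ^ (K'.*2.+1) + window K' * N + x K'%:Z)%N
  else 0%N.

(** The exponents are nonnegative for [z] in the window. On the diagonal this is N^(K - 1 - i), the
    place value of the digit [x i]. *)
Definition window_weight (K : nat) (z : 'rV[int]_d) : nat :=
  (\prod_j n j ^ `|(K%:Z - 1 - z 0%R j)%R|)%N.

Definition window_digit (K : nat) (z : 'rV[int]_d) : nat :=
  (window K %/ window_weight K z %% N)%N.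

Definition in_window (K : nat) (z : 'rV[int]_d) : Prop :=
  forall j, - K%:Z <= z 0 j < K%:Z.

Lemma window_lt K : (window K < N ^ K.*2)%N.
Proof.
elim: K => [|K IHK] //=; rewrite doubleS.
have xl := ltn_ord (x (- K.+1%:Z)); have xr := ltn_ord (x K%:Z).
rewrite -/N in xl xr; rewrite !expnS; move: IHK xl xr.
by move: (x _ : nat) (x _ : nat) (window K) (N ^ K.*2)%N => u v w p; nia.
Qed.

Lemma window_weightS K z :
  in_window K z -> window_weight K.+1 z = (N * window_weight K z)%N.
Proof.
move=> zK; rewrite /window_weight /N /prebasis_prod -big_split.
apply: eq_bigr => j _ /=; rewrite -expnS; congr (_ ^ _)%N.
by have := zK j; lia.
Qed.

(** The product on the left has exponents K - z_j, at most 2K because z_j >= -K. Hence a digit added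
    on top of the window does not affect [window_digit]. *)
Lemma window_weight_dvdn K z :
  in_window K z -> (N * window_weight K z %| N ^ K.*2)%N.
Proof.
move=> zK; rewrite prebasis_prodX /window_weight.
rewrite /N /prebasis_prod -big_split /=.
apply: (big_ind2 (fun a b => a %| b)%N) => // [*|j _]; first exact: dvdn_mul.
by rewrite -expnS dvdn_exp2l//; have := zK j; lia.
Qed.

Lemma window_digitS K z :
  in_window K z -> window_digit K.+1 z = window_digit K z.
Proof.
move=> zK; rewrite /window_digit window_weightS// divnMA /=.
have N_gt0 : (0 < N)%N := prebasis_prod_gt0 n_gt0.
have w_gt0 : (0 < window_weight K z)%N.
  by apply: prodn_gt0 => j; rewrite expn_gt0 n_gt0.
(* Division by N removes the new lowest digit; the new top digit then contributes a multiple of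
   N. *)
rewrite -/N expnSr mulnA -mulnDl divnMDl// [(_ %/ N)%N]divn_small// addn0.
have /dvdnP[c ->] := window_weight_dvdn zK.
by rewrite !mulnA divnMDl// modnMDl.
Qed.

Lemma window_digit_const K (i : int) :
  - K%:Z <= i < K%:Z -> window_digit K (const_mx i) = x i.
Proof.
have N_gt0 : (0 < N)%N := prebasis_prod_gt0 n_gt0.
elim: K => [|K IHK] iK; first lia.
have [iK'|iK'] := boolP (- K%:Z <= i < K%:Z).
  by rewrite window_digitS ?IHK// => j; rewrite mxE.
have weightE k : `|(K.+1%:Z - 1 - i)%R|%N = k ->
    window_weight K.+1 (const_mx i) = (N ^ k)%N.
  move=> <-; rewrite /N prebasis_prodX.
  by apply: eq_bigr => j _; rewrite mxE.
(* Only the two new digits remain: the lowest, of weight 1, and the highest, of weight N^(2K +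
   1). *)
have [iE|iE] : i = K \/ i = - K.+1%:Z by lia.
  rewrite /window_digit (weightE 0%N) ?divn1; last lia.
  rewrite iE /= -modnDml expnSr mulnA -mulnDl modnMl add0n.
  by rewrite modn_small.
rewrite /window_digit (weightE K.*2.+1); last lia.
rewrite iE /= -addnA divnMDl ?expn_gt0 ?N_gt0// divn_small ?addn0 ?modn_small//.
have xr := ltn_ord (x K%:Z); have wK := window_lt K; rewrite -/N in xr.
by rewrite expnSr; move: xr wK; set u := (x _ : nat); nia.
Qed.

Lemma window_digit_match K z i :
  in_window K z -> in_window K (z + evec i) ->
  (window_digit K z %% set_prod n [set~ i] =
   window_digit K (z + evec i)%R %/ n i)%N.
Proof.
move=> zK ziK.
(* Raising z_i by one lowers the exponent of n_i by one, so the weight at [z] is [n i] times that at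
   [z + evec i]. *)
have -> : window_digit K z =
    (window K %/ window_weight K (z + evec i)%R %/ n i %% N)%N.
  rewrite -divnMA; congr (_ %/ _ %% _)%N.
  rewrite /window_weight (bigD1 i)//= [in RHS](bigD1 i)//=.
  rewrite mulnAC -expnSr; congr (_ ^ _ * _)%N.
    by have := ziK i; rewrite !mxE !eqxx /=; lia.
  by apply: eq_bigr => j ji; rewrite !mxE (negPf ji) addr0.
rewrite /window_digit; move: (window K) => w.
rewrite /N (set_prod1C n i) modn_dvdm ?dvdn_mull//.
by rewrite modn_divl mulnC.
Qed.

Lemma window_digit_leq K L z :
  (K <= L)%N -> in_window K z -> window_digit L z = window_digit K z.
Proof.
move=> /subnK <- zK; elim: (L - K)%N => //= m IHm.
by rewrite addSn window_digitS// => j; have := zK j; lia.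
Qed.

(** The successor is there because windows exclude their upper end K. *)
Definition window_radius (z : 'rV[int]_d) : nat := (\max_j `|z 0%R j|).+1.

Lemma in_window_radius z K : (window_radius z <= K)%N -> in_window K z.
Proof.
move=> zK j; have : (`|z 0%R j| <= \max_j `|z 0%R j|)%N := leq_bigmax j.
by move: zK; rewrite /window_radius; lia.
Qed.

Definition diagonal_digits (z : 'rV[int]_d) : nat :=
  window_digit (window_radius z) z.

Lemma diagonal_digits_tessellation : digit_tessellation n diagonal_digits.
Proof.
split=> [z|z i]; first by rewrite ltn_mod prebasis_prod_gt0.
(* Both values are moved to a common window, where matching is known. *)
pose K := maxn (window_radius z) (window_radius (z + evec i)).
rewrite /diagonal_digits -(@window_digit_leq _ K z) ?leq_maxl//; last first.
  exact: in_window_radius.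
rewrite -(@window_digit_leq _ K (z + evec i)) ?leq_maxr//; last first.
  exact: in_window_radius.
by apply: window_digit_match; apply: in_window_radius;
   rewrite ?leq_maxl ?leq_maxr.
Qed.

Lemma diagonal_digits_const (i : int) : diagonal_digits (const_mx i) = x i.
Proof.
(* In dimension 0 the vector [const_mx i] forgets [i], so its radius alone need not bound [i]. *)
have iK : in_window (maxn (window_radius (const_mx i)) `|i|.+1) (const_mx i).
  by apply: in_window_radius; rewrite leq_maxl.
rewrite /diagonal_digits -(window_digit_leq (leq_maxl _ `|i|.+1)); last first.
  exact: in_window_radius.
by rewrite window_digit_const//; lia.
Qed.

End Existence.

Theorem corollary4p39 (d : nat) (n : 'I_d -> nat) (n_prebasis : prebasis n)
    (x : int -> 'I_(prebasis_prod n)) :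
  exists! f : 'rV[int]_d -> cube_type d,
    tessellations n f /\ forall i : int, cube_val (f (const_mx i)) = x i.
Proof.
pose a := diagonal_digits x.
have a_tess : digit_tessellation n a by exact: diagonal_digits_tessellation.
have a_val z : cube_val (cube n (a z)) = a z.
  by rewrite cube_valE// modn_small; case: a_tess.
exists (fun z => cube n (a z)); split.
  split=> [|i]; first exact: digits_tessellation.
  by rewrite a_val; apply: diagonal_digits_const.
move=> g [g_tess g_diag].
have [g_digits ->] := tessellation_digits n_prebasis g_tess.
apply/funext => z; congr cube.
apply: (digit_tessellation_eq a_tess g_digits) => i.
by rewrite g_diag; apply: diagonal_digits_const.
Qed.
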